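(* For every hypergraph $\mathcal{H}$ we have $\inf(U_{\mathcal{H}})=\sup(L_{\mathcal{H}})$ for the Edge-hitter-start fractional transversal game on $\mathcal{H}$, and the analogous equality holds for the Staller-start fractional transversal game on $\mathcal{H}$ (with the corresponding sets of upper bounds and lower bounds defined for the game in which Staller makes the first move).
   Context: A hypergraph $\mathcal{H}=(V,\mathcal{E})$ has a finite vertex set $V$ and an edge set $\mathcal{E}\subseteq 2^V\setminus\{\emptyset\}$. Fractional transversal game on $\mathcal{H}$: two players, Edge-hitter and Staller, take turns making moves and update a cover function $t:V\to[0,1]$. Write $|t|=\sum_{v\in V}t(v)$. The load function corresponding to $t$ is $\ell:\mathcal{E}\to[0,1]$, $\ell(E)=\min\{1,\sum_{v\in E}t(v)\}$. The functions after the $i$-th move are $t_i,\ell_i$; the game begins with $t_0\equiv 0$, $\ell_0\equiv 0$. The game is finished when $\mathcal{H}$ is fully covered, i.e. $\ell\equiv 1$. As long as $\ell\not\equiv1$, the next player performs a move, which is a finite or infinite sequence of submoves $(u_1,w_1),(u_2,w_2),\dots$, where $u_k\in V$ (repetitions allowed) and the weights $w_k$ are reals in $[0,1]$. It is required that $\sum_{k\ge1}w_k=1$ in each move except the last move of the game, where $\sum_{k\ge1}w_k\le1$ suffices. The $i$-th move must be legal: for every $k\ge1$ there is an edge $E\in\mathcal{E}$ with $u_k\in E$ and $$\ell_{i-1}(E)+\sum_{1\le s\le k-1,\ u_s\in E}w_s+w_k\le1.$$ The function $t_i$ is obtained from $t_{i-1}$ by adding $w_k$ to the value at $u_k$ for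 every submove. The value $|\mathcal{G}|$ of a game is $|t_q|$, where $t_q$ is the cover function at the end (the total weight spent). Edge-hitter wants $|\mathcal{G}|$ small, Staller wants it large. When Edge-hitter starts, $U_{\mathcal{H}}=\{a:\text{Edge-hitter has a strategy that ensures }|\mathcal{G}|\le a\}$ and $L_{\mathcal{H}}=\{b:\text{Staller has a strategy that ensures }|\mathcal{G}|\ge b\}$. *)

(* Defs.v *)
From mathcomp Require Import all_boot all_order all_algebra.
From mathcomp Require Import all_classical all_reals all_analysis.
Set Implicit Arguments.
Unset Strict Implicit.
Unset Printing Implicit Defensive.
Import Order.TTheory GRing.Theory Num.Theory.
Local Open Scope classical_set_scope.
Local Open Scope ring_scope.

Inductive player := EdgeHitter | Staller.

Definition opponent (p : player) : player :=
  match p with EdgeHitter => Staller | Staller => EdgeHitter end.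

Section FractionalTransversalGame.
Variables (R : realType) (V : finType) (E : {set {set V}}).

Inductive move :=
  | FiniteMove of seq (V * R)
  | InfiniteMove of (nat -> V * R).

(* Submoves are indexed from 0; None means that the sequence is exhausted. *)
Definition submove (m : move) (k : nat) : option (V * R) :=
  match m with
  | FiniteMove s => onth s k
  | InfiniteMove f => Some (f k)
  end.

Definition weight_on (m : move) (A : {set V}) (k : nat) : R :=
  if submove m k is Some (u, w) then (if u \in A then w else 0) else 0.

(* The sum is taken in the extended reals, so that a divergent series of
   nonnegative weights has total +oo rather than a default real value. *)
Definition move_weight (m : move) (A : {set V}) : \bar R :=
  (\sum_(0 <= k <oo) (weight_on m A k)%:E)%E.

Definition load (t : V -> R) (e : {set V}) : R :=
  Num.min 1 (\sum_(v in e) t v).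

Definition fully_covered (t : V -> R) : bool :=
  [forall e in E, load t e == 1].

(* For a legal move all weights are nonnegative with total at most 1, so
   [fine] is applied to a real number. *)
Definition apply_move (t : V -> R) (m : move) : V -> R :=
  fun v => t v + fine (move_weight m [set v]%SET).

Definition legal_submoves (t : V -> R) (m : move) : Prop :=
  forall (k : nat) (u : V) (w : R), submove m k = Some (u, w) ->
    0 <= w <= 1 /\
    exists e : {set V}, [/\ e \in E, u \in e &
      load t e + \sum_(s < k) weight_on m e s + w <= 1].

(* A move is the last one of the game iff it makes the hypergraph fully
   covered; only then may its total weight be smaller than 1. *)
Definition legal_move (t : V -> R) (m : move) : Prop :=
  legal_submoves t m /\
  (move_weight m [set: V]%SET = 1%:E \/
   (move_weight m [set: V]%SET <= 1%:E)%E /\ fully_covered (apply_move t m)).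

(* A history is the list of the moves made so far, oldest first. *)
Definition cover_after (h : seq move) : V -> R :=
  foldl apply_move (fun=> 0) h.

Definition legal_history (h : seq move) : Prop :=
  forall (h1 : seq move) (m : move) (h2 : seq move), h = h1 ++ m :: h2 ->
    ~~ fully_covered (cover_after h1) /\ legal_move (cover_after h1) m.

(* Legality keeps t at most 1 at every vertex, and every move but the last adds
   weight exactly 1, so every game reaches a finished history and
   infinite plays need not be considered. *)
Definition finished_game (h : seq move) : Prop :=
  legal_history h /\ fully_covered (cover_after h).

Definition game_value (h : seq move) : R := \sum_(v : V) cover_after h v.

Definition to_move (first : player) (h : seq move) : player :=
  if odd (size h) then opponent first else first.

Definition is_strategy (first p : player) (sigma : seq move -> move) : Prop :=
  forall h : seq move, legal_history h -> ~~ fully_covered (cover_after h) ->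
    to_move first h = p -> legal_move (cover_after h) (sigma h).

Definition follows (first p : player) (sigma : seq move -> move)
    (h : seq move) : Prop :=
  forall (h1 : seq move) (m : move) (h2 : seq move), h = h1 ++ m :: h2 ->
    to_move first h1 = p -> m = sigma h1.

Definition upper_bounds (first : player) : set R :=
  [set a | exists2 sigma : seq move -> move,
    is_strategy first EdgeHitter sigma &
    forall h, finished_game h -> follows first EdgeHitter sigma h ->
      game_value h <= a].

Definition lower_bounds (first : player) : set R :=
  [set b | exists2 sigma : seq move -> move,
    is_strategy first Staller sigma &
    forall h, finished_game h -> follows first Staller sigma h ->
      b <= game_value h].

End FractionalTransversalGame.

Arguments upper_bounds R {V} E first.
Arguments lower_bounds R {V} E first.

(* Main.v *)
Require Import Defs.
From mathcomp Require Import all_boot all_order all_algebra.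
From mathcomp Require Import all_classical all_reals all_analysis.
From mathcomp Require Import lra.
Set Implicit Arguments.
Unset Strict Implicit.
Unset Printing Implicit Defensive.
Import Order.TTheory GRing.Theory Num.Theory.
Local Open Scope classical_set_scope.
Local Open Scope ring_scope.

(** The game is a win-or-lose game for each threshold [a], Edge-hitter winning
when the value is at most [a], and such games are determined by Zermelo's
argument. Call a position good when Edge-hitter can force a value at most [a]
from it ([forces]). On a good position Edge-hitter has a move, or Staller has
only moves, to good positions; on a bad position the roles are exchanged. So if
the start is good Edge-hitter can keep the play in good positions, and otherwise
Staller can keep it in bad ones ([invariant_strategy], [zermelo]). Hence every
real [a] is an upper bound that Edge-hitter can ensure or a lower bound that
Staller can ensure, and no number lies strictly between the supremum of the
lower bounds and the infimum of the upper bounds.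

The reverse inequality comes from letting two strategies play against each other
([play_exists]), and it needs the actual rules of the game. A play cannot
get stuck, as every position has a legal move ([legal_move_exists]): fill
uncovered edges one at a time until the budget of the move is spent or nothing
is left to cover. A play cannot go on forever, since legality keeps the cover at
most 1 on each vertex ([move_weight_vertex_le]) while each move but the last
adds total weight 1. The first of these bounds also shows that all values lie
between 0 and the number of vertices, so both sets are bounded and nonempty. *)

Section Game.
Context {R : realType} {V : finType} (E : {set {set V}}).
Implicit Types (t : V -> R) (m : move R V) (A B e : {set V}) (s : seq (V * R)).
Implicit Types (h : seq (move R V)) (p first : player).

(** * Weights and covers *)

Lemma fully_coveredP t :
  reflect (forall e, e \in E -> 1 <= \sum_(v in e) t v) (fully_covered E t).
Proof.
rewrite /fully_covered.
by apply: (iffP forall_inP) => H e /H; rewrite /load eq_minl.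
Qed.

Lemma weight_on_ge0 t m A k : legal_submoves E t m -> 0 <= weight_on m A k.
Proof.
move=> lm; rewrite /weight_on; case: submove (lm k) => // -[u w] /(_ u w erefl).
by case=> /andP[w0 _] _; case: ifP.
Qed.

Lemma weight_on_sub t m A B k :
  legal_submoves E t m -> A \subset B -> weight_on m A k <= weight_on m B k.
Proof.
move=> lm AB; have := lm k; rewrite /weight_on.
case: submove => // -[u w] /(_ u w erefl)[/andP[w0 _] _].
by case: ifP => [/(fintype.subsetP AB) ->//|_]; case: ifP.
Qed.

Lemma weight_on_sum m A k :
  weight_on m A k = \sum_(v in A) weight_on m [set v]%SET k.
Proof.
rewrite /weight_on; case: submove => [[u w]|]; last by rewrite big1.
case: ifPn => uA.
  rewrite (bigD1 u)//= inE eqxx big1 ?addr0// => v /andP[_ vu].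
  by rewrite inE eq_sym (negPf vu).
rewrite big1// => v vA; rewrite inE; case: eqP => // uv.
by rewrite uv vA in uA.
Qed.

Lemma move_weight_ge0 t m A : legal_submoves E t m -> (0 <= move_weight m A)%E.
Proof.
move=> lm; apply: nneseries_ge0 => k _ _.
by rewrite lee_fin (weight_on_ge0 _ _ lm).
Qed.

(** Bounding every partial sum bounds the total weight, whether the move is
    finite or infinite. *)
Lemma move_weight_le t m A c : legal_submoves E t m ->
  (forall n, \sum_(k < n) weight_on m A k <= c) -> (move_weight m A <= c%:E)%E.
Proof.
move=> lm H; apply: lime_le.
  by apply: is_cvg_nneseries => k _ _; rewrite lee_fin (weight_on_ge0 _ _ lm).
by apply: nearW => n; rewrite sumEFin lee_fin big_mkord.
Qed.

Lemma move_weight_sum t m A : legal_submoves E t m ->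
  (move_weight m A = \sum_(v in A) move_weight m [set v]%SET)%E.
Proof.
move=> lm; rewrite /move_weight -nneseries_sum; last first.
  by move=> v k _; rewrite lee_fin (weight_on_ge0 _ _ lm).
by apply: eq_eseriesr => k _; rewrite weight_on_sum sumEFin.
Qed.

(** A positive weight is only ever put on a vertex [v] lying in an edge [e]
    with load below 1, so the load of [e] is then the full sum of the cover
    over [e], and the legality bound on [e] bounds the cover of [v]. *)
Lemma move_weight_vertex_le t m v : (forall u, 0 <= t u <= 1) ->
  legal_submoves E t m -> (move_weight m [set v]%SET <= (1 - t v)%:E)%E.
Proof.
move=> t01 lm; apply: (move_weight_le lm) => n.
have t0 u : 0 <= t u by case/andP: (t01 u).
elim: n => [|n IHn].
  by rewrite big_ord0 subr_ge0; case/andP: (t01 v).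
rewrite big_ord_recr/=.
case Em: (submove m n) => [[u w]|]; last by rewrite /weight_on Em addr0.
rewrite {2}/weight_on Em inE; case: eqP => [uv|_]; last by rewrite addr0.
have [] := lm _ _ _ Em; rewrite {}uv => /andP[w0 _] [e [eE ve He]].
have [->|wn0] := eqVneq w 0; first by rewrite addr0.
have wgt0 : 0 < w by rewrite lt_def wn0.
have ve_le :
    \sum_(k < n) weight_on m [set v]%SET k <= \sum_(k < n) weight_on m e k.
  by apply: ler_sum => k _; apply: (weight_on_sub _ lm); rewrite finset.sub1set.
have prior0 : 0 <= \sum_(k < n) weight_on m e k.
  by apply: sumr_ge0 => k _; apply: (weight_on_ge0 _ _ lm).
have tv_le : t v <= \sum_(x in e) t x.
  by rewrite (bigD1 v)//= lerDl sumr_ge0.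
move: He; rewrite /load; case: (leP 1 (\sum_(x in e) t x)) => _; lra.
Qed.

(** The weights of a move add up over any vertex set, so covers can be updated
    edgewise. *)
Lemma sum_apply_move t m A : legal_submoves E t m ->
  (move_weight m [set: V]%SET <= 1%:E)%E ->
  (\sum_(v in A) apply_move t m v)%:E =
    ((\sum_(v in A) t v)%:E + move_weight m A)%E.
Proof.
move=> lm m1; rewrite big_split/= EFinD; congr (_ + _)%E.
rewrite EFin_sum_fine; first exact: esym (move_weight_sum _ lm).
move=> v _; rewrite ge0_fin_numE; last exact: move_weight_ge0 lm.
apply: le_lt_trans (ltry 1); apply: le_trans m1.
rewrite (move_weight_sum [set: V]%SET lm) (bigD1 v) ?inE//=.
by rewrite leeDl// sume_ge0// => u _; exact: move_weight_ge0 lm.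
Qed.

(** * Existence of legal moves *)

Lemma sum_weight_on_take s A k :
  \sum_(i < k) weight_on (FiniteMove s) A i =
    \sum_(p <- take k s | p.1 \in A) p.2.
Proof.
elim: s k => [|[u w] s IHs] [|k]; rewrite ?take0 ?big_nil ?big_ord0//.
  by rewrite big1// => i _; rewrite /weight_on/= onth0n.
rewrite big_ord_recl take_cons big_cons -IHs /weight_on/=.
by case: ifP; rewrite ?add0r.
Qed.

Lemma move_weight_finite s A :
  move_weight (FiniteMove s) A = (\sum_(p <- s | p.1 \in A) p.2)%:E.
Proof.
apply: lim_near_cst => //; near=> n.
rewrite sumEFin big_mkord sum_weight_on_take take_oversize//.
by near: n; exact: nbhs_infty_ge.
Unshelve. all: by end_near. Qed.

Lemma sum_apply_finite t s A : legal_submoves E t (FiniteMove s) ->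
  \sum_(p <- s) p.2 <= 1 ->
  \sum_(v in A) apply_move t (FiniteMove s) v =
    \sum_(v in A) t v + \sum_(p <- s | p.1 \in A) p.2.
Proof.
move=> lm s1; apply: EFin_inj; rewrite sum_apply_move//.
  by rewrite move_weight_finite.
by rewrite move_weight_finite lee_fin; under eq_bigl do rewrite inE.
Qed.

(** The load is at most the full sum of the cover over the edge, so the bound
    without truncation is enough for legality. *)
Lemma legal_submoves_rcons t s u w e : legal_submoves E t (FiniteMove s) ->
  0 <= w <= 1 -> e \in E -> u \in e ->
  \sum_(v in e) t v + \sum_(p <- s | p.1 \in e) p.2 + w <= 1 ->
  legal_submoves E t (FiniteMove (rcons s (u, w))).
Proof.
move=> ls w01 eE ue le1 k u' w' /=; rewrite -cats1 onth_cat.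
case: ltnP => ks Ek.
  have [w'01 [e' [e'E ue' le']]] := ls _ _ _ Ek.
  split=> //; exists e'; split=> //.
  by rewrite sum_weight_on_take takel_cat ?(ltnW ks)// -sum_weight_on_take.
have /onth1P[/eqP sk [<- <-]] := Ek.
have {sk}-> : k = size s by apply/eqP; rewrite eqn_leq ks -subn_eq0 sk.
split=> //; exists e; split=> //.
rewrite sum_weight_on_take take_size_cat//; apply: le_trans le1.
by rewrite !lerD2r /load ge_min lexx orbT.
Qed.

(** As long as budget is left and some edge is not covered, a vertex of that
    edge can receive either the whole deficit of the edge or the whole remaining
    budget. In the first case the number of uncovered edges drops, in the
    second the move is complete. *)
Lemma complete_move t s : finset.set0 \notin E ->
  legal_submoves E t (FiniteMove s) -> \sum_(p <- s) p.2 <= 1 ->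
  exists m, legal_move E t m.
Proof.
move=> E0.
have [n] := ubnP #|[set e in E |
  \sum_(v in e) t v + \sum_(p <- s | p.1 \in e) p.2 < 1]%SET|.
elim: n s => // n IHn s; rewrite ltnS => card_n ls s1.
have sT : move_weight (FiniteMove s) [set: V]%SET = (\sum_(p <- s) p.2)%:E.
  by rewrite move_weight_finite; under eq_bigl do rewrite inE.
have [cov|] := boolP (fully_covered E (apply_move t (FiniteMove s))).
  by exists (FiniteMove s); split=> //; right; rewrite sT lee_fin.
move=> /fully_coveredP/existsNP[e /not_implyP[eE /negP]].
rewrite -ltNge sum_apply_finite// => e_lt1.
have /finset.set0Pn[u ue] : e != finset.set0 by apply: contraNneq E0 => <-.
set d := 1 - (\sum_(v in e) t v + \sum_(p <- s | p.1 \in e) p.2).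
set b := 1 - \sum_(p <- s) p.2.
have s0 : 0 <= \sum_(p <- s) p.2.
  by rewrite -lee_fin -sT; exact: move_weight_ge0 ls.
have d0 : 0 < d by rewrite subr_gt0.
have b0 : 0 <= b by rewrite subr_ge0.
have w0 : 0 <= Num.min d b by rewrite le_min (ltW d0).
have wd : Num.min d b <= d by rewrite ge_min lexx.
have wb : Num.min d b <= b by rewrite ge_min lexx orbT.
have ls' : legal_submoves E t (FiniteMove (rcons s (u, Num.min d b))).
  apply: (legal_submoves_rcons ls _ eE ue).
    by rewrite w0/=; rewrite /b in wb; lra.
  by rewrite /d in wd; lra.
have sum' : \sum_(p <- rcons s (u, Num.min d b)) p.2 =
    \sum_(p <- s) p.2 + Num.min d b.
  by rewrite big_rcons.
have [bd|db] := leP b d.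
  exists (FiniteMove (rcons s (u, Num.min d b))); split=> //; left.
  rewrite move_weight_finite; under eq_bigl do rewrite inE.
  by rewrite sum' min_r// /b; congr (_%:E); lra.
apply: (IHn _ _ ls'); last by rewrite sum'; rewrite /b in wb; lra.
apply: leq_trans card_n; apply: proper_card; apply/fintype.properP; split.
  apply/fintype.subsetP => e'; rewrite !inE => /andP[->/=]; rewrite big_rcons/=.
  by case: ifP => _; lra.
exists e; rewrite !inE eE//= big_rcons/= ue min_l ?(ltW db)// -leNgt /d; lra.
Qed.

Lemma legal_move_exists t : finset.set0 \notin E -> exists m, legal_move E t m.
Proof.
move=> E0; apply: (@complete_move t [::]) => //; last by rewrite big_nil.
by move=> k u w /=; rewrite onth0n.
Qed.

(** * Histories *)

(** Both the legality of a history and the adherence to a strategy quantify over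
    all ways of cutting a list at one of its elements. *)
Lemma forall_split_rcons (T : Type) (Q : seq T -> T -> Prop) (l : seq T) x :
  (forall l1 y l2, rcons l x = l1 ++ y :: l2 -> Q l1 y) <->
  (forall l1 y l2, l = l1 ++ y :: l2 -> Q l1 y) /\ Q l x.
Proof.
split=> [H|[H Hx] l1 y l2].
  split=> [l1 y l2 El|]; last by apply: (H l x [::]); rewrite cats1.
  by apply: (H l1 y (rcons l2 x)); rewrite El rcons_cat.
case: (lastP l2) => [|l2' z]; first by rewrite cats1 => /rcons_inj[<- <-].
by rewrite -rcons_cons -rcons_cat => /rcons_inj[/H].
Qed.

Lemma legal_history_rcons h m : legal_history E (rcons h m) <->
  legal_history E h /\
  (~~ fully_covered E (cover_after h) /\ legal_move E (cover_after h) m).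
Proof.
exact: (forall_split_rcons (fun h m =>
  ~~ fully_covered E (cover_after h) /\ legal_move E (cover_after h) m)).
Qed.

Lemma follows_rcons first p sigma h m : follows first p sigma (rcons h m) <->
  follows first p sigma h /\ (to_move first h = p -> m = sigma h).
Proof.
exact: (forall_split_rcons (fun h m => to_move first h = p -> m = sigma h)).
Qed.

Lemma legal_history_nil : legal_history E ([::] : seq (move R V)).
Proof. by case. Qed.

Lemma follows_nil first p (sigma : seq (move R V) -> move R V) :
  follows first p sigma [::].
Proof. by case. Qed.

Lemma cover_after_rcons h m :
  cover_after (rcons h m) = apply_move (cover_after h) m.
Proof. by rewrite /cover_after foldl_rcons. Qed.

Lemma cover_after_bounds h v : legal_history E h -> 0 <= cover_after h v <= 1.
Proof.
elim/last_ind: h v => [|h m IHh] v; first by rewrite lexx ler01.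
move=> /legal_history_rcons[lh [_ [lm _]]]; rewrite cover_after_rcons.
have m0 := move_weight_ge0 [set v]%SET lm.
have m1 := move_weight_vertex_le v (fun u => IHh u lh) lm.
have /andP[c0 _] := IHh v lh.
have mfin : move_weight m [set v]%SET \is a fin_num.
  by rewrite ge0_fin_numE// (le_lt_trans m1) ?ltry.
move: m0 m1; rewrite /apply_move -(fineK mfin) !lee_fin fineK//; lra.
Qed.

Lemma game_value_ge0 h : legal_history E h -> 0 <= game_value h.
Proof.
move=> lh; apply: sumr_ge0 => v _.
by case/andP: (cover_after_bounds v lh).
Qed.

Lemma game_value_le_card h : legal_history E h -> game_value h <= #|V|%:R.
Proof.
move=> lh; rewrite -sum1_card natr_sum; apply: ler_sum => v _.
by case/andP: (cover_after_bounds v lh).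
Qed.

(** Only the move that finishes the game may weigh less than 1. *)
Lemma game_value_unfinished h : legal_history E h ->
  ~~ fully_covered E (cover_after h) -> game_value h = (size h)%:R.
Proof.
elim/last_ind: h => [|h m IHh]; first by rewrite /game_value big1.
move=> /legal_history_rcons[lh [ncov [lm mw]]].
rewrite /game_value cover_after_rcons => ncov'.
case: mw => [m1|[_ cov]]; last by rewrite cov in ncov'.
apply: EFin_inj.
have := sum_apply_move [set: V]%SET lm; rewrite m1 lexx => /(_ erefl).
under eq_bigl do rewrite inE; move=> ->.
under eq_bigl do rewrite inE.
by rewrite size_rcons -natr1 EFinD -IHh.
Qed.

Lemma size_unfinished h : legal_history E h ->
  ~~ fully_covered E (cover_after h) -> (size h <= #|V|)%N.
Proof.
move=> lh ncov; rewrite -(ler_nat R) -game_value_unfinished//.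
exact: game_value_le_card.
Qed.

(** * Determinacy *)

Lemma to_move_opponent first h p : to_move first h <> p ->
  to_move first h = opponent p.
Proof. by case: (to_move first h) p => [] []. Qed.

Lemma opponent_neq p : opponent p <> p. Proof. by case: p. Qed.

(** Each history falls to exactly one player, so the two strategies determine
    a play; it ends since an unfinished history with [n] moves has weight [n],
    while the cover never exceeds 1 at a vertex. *)
Lemma play_exists first p sigma tau :
  is_strategy E first p sigma -> is_strategy E first (opponent p) tau ->
  exists h, [/\ finished_game E h, follows first p sigma h &
    follows first (opponent p) tau h].
Proof.
move=> ssigma stau.
suff play n h : (#|V| < size h + n)%N -> legal_history E h ->
    follows first p sigma h -> follows first (opponent p) tau h ->
    exists h, [/\ finished_game E h, follows first p sigma h &
      follows first (opponent p) tau h].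
  apply: (play #|V|.+1 [::]) => //;
    [exact: legal_history_nil|exact: follows_nil|exact: follows_nil].
elim: n h => [|n IHn] h hn lh fs ft;
  have [cov|ncov] := boolP (fully_covered E (cover_after h)); try by exists h.
  by have := size_unfinished lh ncov; rewrite leqNgt -[size h]addn0 hn.
have [hp|/to_move_opponent hp] := pselect (to_move first h = p).
  apply: (IHn (rcons h (sigma h))); first by rewrite size_rcons addSnnS.
  - by apply/legal_history_rcons; do 2?split=> //; exact: ssigma.
  - by apply/follows_rcons.
  - by apply/follows_rcons; split=> //; rewrite hp => /esym/opponent_neq.
apply: (IHn (rcons h (tau h))); first by rewrite size_rcons addSnnS.
- by apply/legal_history_rcons; do 2?split=> //; exact: stau.
- by apply/follows_rcons; split=> //; rewrite hp => /opponent_neq.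
- by apply/follows_rcons.
Qed.

(** The strategy moves within [W] where it can and makes an arbitrary legal move
    elsewhere, so that it is legal on every position; from a start in [W] the
    arbitrary moves never occur. *)
Lemma invariant_strategy first p (W : seq (move R V) -> Prop) :
  finset.set0 \notin E -> W [::] ->
  (forall h, W h -> ~~ fully_covered E (cover_after h) -> to_move first h = p ->
    exists2 m, legal_move E (cover_after h) m & W (rcons h m)) ->
  (forall h, W h -> ~~ fully_covered E (cover_after h) ->
    to_move first h <> p ->
    forall m, legal_move E (cover_after h) m -> W (rcons h m)) ->
  exists2 sigma, is_strategy E first p sigma &
    forall h, finished_game E h -> follows first p sigma h -> W h.
Proof.
move=> E0 W0 own other.
have /boolp.choice[sigma sigmaP] : forall h, exists m,
    legal_move E (cover_after h) m /\
    (W h -> ~~ fully_covered E (cover_after h) -> to_move first h = p ->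
     W (rcons h m)).
  move=> h; have [m lm] := legal_move_exists (cover_after h) E0.
  have [[Wh ncov hp]|no] := pselect
    [/\ W h, ~~ fully_covered E (cover_after h) & to_move first h = p].
    by have [m' lm' Wm'] := own h Wh ncov hp; exists m'.
  by exists m; split=> // *; case: no.
exists sigma; first by move=> h _ _ _; case: (sigmaP h).
suff WH h : legal_history E h -> follows first p sigma h -> W h.
  by move=> h [lh _]; exact: WH.
elim/last_ind: h => // h m IHh.
move=> /legal_history_rcons[lh [ncov lm]] /follows_rcons[fh msigma].
have Wh := IHh lh fh.
have [hp|hp] := pselect (to_move first h = p); last exact: other.
by rewrite msigma//; case: (sigmaP h) => _; apply.
Qed.

(** A position belongs to this family exactly when the one-step rule puts it
    there. Read in one direction, this makes the family an invariant that [p]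
    can maintain; read in the other, it makes the complement an invariant that
    the opponent can maintain. *)
Inductive forces first p (P : seq (move R V) -> Prop) :
  seq (move R V) -> Prop :=
| Forces_end h of fully_covered E (cover_after h) & P h : forces first p P h
| Forces_own h m of ~~ fully_covered E (cover_after h) & to_move first h = p &
    legal_move E (cover_after h) m & forces first p P (rcons h m) :
    forces first p P h
| Forces_other h of ~~ fully_covered E (cover_after h) & to_move first h <> p &
    (forall m, legal_move E (cover_after h) m -> forces first p P (rcons h m)) :
    forces first p P h.

Lemma zermelo first p (P : seq (move R V) -> Prop) : finset.set0 \notin E ->
  (exists2 sigma, is_strategy E first p sigma &
    forall h, finished_game E h -> follows first p sigma h -> P h) \/
  (exists2 tau, is_strategy E first (opponent p) tau &
    forall h, finished_game E h -> follows first (opponent p) tau h -> ~ P h).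
Proof.
move=> E0; have [W0|W0] := pselect (forces first p P [::]); [left|right].
  have [||sigma ssigma sigmaW] := @invariant_strategy first p _ E0 W0.
  - move=> h; case=> {h}[h cov _|h m ncov hp lm Wm _ _|h ncov hp _ _ /hp]//.
      by rewrite cov.
    by exists m.
  - move=> h; case=> {h}[h cov _|h m ncov hp _ _ _ /(_ hp)|h ncov hp Wm _ _]//.
    by rewrite cov.
  exists sigma => // h fh fs; case: (fh) => _ cov.
  by case: (sigmaW h fh fs) cov => [//|h' m|h'] /negPf->.
have [||tau stau tauW] :=
  @invariant_strategy first (opponent p) (fun h => ~ forces first p P h) E0 W0.
- move=> h nW ncov hp; apply: contrapT => no; apply: nW.
  apply: Forces_other => // [|m lm].
    by rewrite hp; exact: opponent_neq.
  by apply: contrapT => nWm; apply: no; exists m.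
- move=> h nW ncov hp m lm Wm; apply: nW; apply: (Forces_own ncov _ lm Wm).
  by apply: contrapT => /to_move_opponent.
exists tau => // h fh ft Ph; apply: (tauW h fh ft); apply: Forces_end => //.
by case: fh.
Qed.

(** * The value of the game *)

Lemma lower_le_upper first a b : upper_bounds R E first a ->
  lower_bounds R E first b -> b <= a.
Proof.
move=> [sigma ssigma sigmaP] [tau stau tauP].
have [h [fh fs ft]] :=
  play_exists ssigma (stau : is_strategy E first (opponent EdgeHitter) tau).
by rewrite (le_trans (tauP h fh ft))// sigmaP.
Qed.

(** When Edge-hitter cannot ensure a value at most [a], Staller ensures one
    strictly above [a], hence at least [a]. *)
Lemma upper_or_lower first a : finset.set0 \notin E ->
  upper_bounds R E first a \/ lower_bounds R E first a.
Proof.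
move=> E0; have [U|[tau stau tauP]] :=
  zermelo first EdgeHitter (fun h => game_value h <= a) E0; first by left.
right; exists tau => // h fh ft; apply/ltW; rewrite ltNge; apply/negP.
exact: tauP.
Qed.

Lemma upper_bounds_card first : finset.set0 \notin E ->
  upper_bounds R E first #|V|%:R.
Proof.
move=> E0; have [//|//|sigma ssigma _] :=
  @invariant_strategy first EdgeHitter (fun=> True) E0 I.
- move=> h _ _ _; have [m] := legal_move_exists (cover_after h) E0.
  by exists m.
by exists sigma => // h [lh _] _; exact: game_value_le_card.
Qed.

Lemma lower_bounds0 first : finset.set0 \notin E -> lower_bounds R E first 0.
Proof.
move=> E0; have [//|//|sigma ssigma _] :=
  @invariant_strategy first Staller (fun=> True) E0 I.
- move=> h _ _ _; have [m] := legal_move_exists (cover_after h) E0.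
  by exists m.
by exists sigma => // h [lh _] _; exact: game_value_ge0.
Qed.

Lemma game_determined first : finset.set0 \notin E ->
  [/\ has_inf (upper_bounds R E first), has_sup (lower_bounds R E first)
    & inf (upper_bounds R E first) = sup (lower_bounds R E first)].
Proof.
move=> E0.
have Ucard := upper_bounds_card first E0; have L0 := lower_bounds0 first E0.
have Uinf : has_inf (upper_bounds R E first).
  by split; [exists #|V|%:R|exists 0 => a Ua; exact: lower_le_upper Ua L0].
have Lsup : has_sup (lower_bounds R E first).
  by split; [exists 0|exists #|V|%:R => b; exact: lower_le_upper Ucard].
split=> //; apply/eqP; rewrite eq_le; apply/andP; split; last first.
  apply: ge_sup => [|b Lb]; first by exists 0.
  by apply: lb_le_inf => [|a Ua]; [exists #|V|%:R|exact: lower_le_upper Ua Lb].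
rewrite leNgt; apply/negP => gap.
set c := (sup (lower_bounds R E first) + inf (upper_bounds R E first)) / 2.
have [Uc|Lc] := upper_or_lower first c E0.
  by have := ge_inf Uinf.2 Uc; rewrite /c; lra.
by have := ub_le_sup Lsup.2 Lc; rewrite /c; lra.
Qed.

End Game.

Theorem proposition1 (R : realType) (V : finType) (E : {set {set V}})
    (hE : finset.set0 \notin E) :
  [/\ has_inf (upper_bounds R E EdgeHitter),
      has_sup (lower_bounds R E EdgeHitter)
    & inf (upper_bounds R E EdgeHitter) = sup (lower_bounds R E EdgeHitter)] /\
  [/\ has_inf (upper_bounds R E Staller),
      has_sup (lower_bounds R E Staller)
    & inf (upper_bounds R E Staller) = sup (lower_bounds R E Staller)].
Proof. by split; exact: game_determined. Qed.
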